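(* Let $\mathbf U=\langle\langle U,\approx\rangle,\preceq\rangle$ be an $\mathbf L$-ordered set and $M\subseteq L^U$ a subset containing only convex $\mathbf L$-sets in $\mathbf U$. Then $\langle\langle M,\approx^{+}\rangle,\preceq^{+}\rangle$ (the power relations restricted to $M$) is an $\mathbf L$-ordered set.
   Context: $\mathbf L=\langle L,\wedge,\vee,\otimes,\to,0,1\rangle$ is a complete residuated lattice ($\langle L,\wedge,\vee,0,1\rangle$ complete lattice, $\langle L,\otimes,1\rangle$ commutative monoid, $a\otimes b\le c$ iff $a\le b\to c$). An $\mathbf L$-set in $X$ is a map $X\to L$; $L^X$ the set of them; $A\subseteq B$ iff $A(x)\le B(x)$ for all $x$; $\cap$ is pointwise $\wedge$; $S(A,B)=\bigwedge_x(A(x)\to B(x))$. An $\mathbf L$-equality on $X$ is a binary $\mathbf L$-relation (map $X\times X\to L$) that is reflexive, symmetric, transitive ($R(x,y)\otimes R(y,z)\le R(x,z)$) and with $R(x,y)=1\Rightarrow x=y$. An $\mathbf L$-ordered set is $\langle\langle U,\approx\rangle,\preceq\rangle$ with $\approx$ an $\mathbf L$-equality and $\preceq$ a reflexive, transitive binary $\mathbf L$-relation compatible with $\approx$ (i.e. $(u\preceq v)\otimes(u\approx u')\otimes(v\approx v')\le(u'\preceq v')$) and with $(u\preceq v)\wedge(v\preceq u)\le u\approx v$. For $V\in L^U$: $\downarrow V(u)=\bigvee_{v}(u\preceq v)\otimes V(v)$, $\uparrow V(u)=\bigvee_v(v\preceq u)\otimes V(v)$; $V$ is convex if $V=\downarrow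 V\cap\uparrow V$. For a binary $\mathbf L$-relation $R$ on a set $X$ and $A,B\in L^X$: $(R\circ B)(x)=\bigvee_y R(x,y)\otimes B(y)$, $(A\circ R)(y)=\bigvee_x A(x)\otimes R(x,y)$, $R^+(A,B)=S(A,R\circ B)\wedge S(B,A\circ R)$. *)

(* Defs.v *)
From HB Require Import structures.
From mathcomp Require Import all_boot all_order.
From mathcomp Require Import boolp classical_sets.

Set Implicit Arguments.
Unset Strict Implicit.
Unset Printing Implicit Defensive.

Import Order.TTheory.
Local Open Scope classical_set_scope.
Local Open Scope order_scope.

HB.mixin Record isCompleteLattice d (L : Type) of Order.TBLattice d L := {
  has_supremum : forall A : set L, supremums A !=set0;
  has_infimum : forall A : set L, infimums A !=set0
}.

#[short(type="completeLatticeType")]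
HB.structure Definition CompleteLattice d :=
  {L of Order.TBLattice d L & isCompleteLattice d L}.

HB.mixin Record isResiduated d (L : Type) of Order.TBLattice d L := {
  tensor : L -> L -> L;
  residuum : L -> L -> L;
  tensorA : associative tensor;
  tensorC : commutative tensor;
  tensor1l : left_id \top tensor;
  adjointness : forall a b c : L, (tensor a b <= c) = (a <= residuum b c)
}.

#[short(type="completeResiduatedLatticeType")]
HB.structure Definition CompleteResiduatedLattice d :=
  {L of CompleteLattice d L & isResiduated d L}.

Notation "a ⊗ b" := (tensor a b) (at level 40, left associativity) : order_scope.
Notation "a ⇒ b" := (residuum a b) (at level 55, right associativity) : order_scope.

(* [supremum] and [infimum] return their first argument on the empty set, so
   the defaults [\bot] and [\top] give the empty join and the empty meet. *)
Definition bigjoin d (L : completeLatticeType d) (I : Type) (F : I -> L) : L :=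
  supremum \bot (range F).
Definition bigmeet d (L : completeLatticeType d) (I : Type) (F : I -> L) : L :=
  infimum \top (range F).

Notation "⋁ x , F" := (bigjoin (fun x => F))
  (at level 60, x binder, F at level 60) : order_scope.
Notation "⋀ x , F" := (bigmeet (fun x => F))
  (at level 60, x binder, F at level 60) : order_scope.

Section LSets.
Context {d : Order.disp_t} {L : completeResiduatedLatticeType d}.

Definition Lset (X : Type) := X -> L.
Definition Lrel (X : Type) := X -> X -> L.

Definition Lsubsethood X (A B : Lset X) : L := ⋀ x, (A x ⇒ B x).
Definition Lsetcap X (A B : Lset X) : Lset X := fun x => A x `&` B x.

Definition Lreflexive X (R : Lrel X) := forall x, R x x = \top.
Definition Lsymmetric X (R : Lrel X) := forall x y, R x y = R y x.
Definition Ltransitive X (R : Lrel X) :=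
  forall x y z, R x y ⊗ R y z <= R x z.

Record Lequality X (E : Lrel X) : Prop := {
  Lequality_refl : Lreflexive E;
  Lequality_sym : Lsymmetric E;
  Lequality_trans : Ltransitive E;
  Lequality_sep : forall x y, E x y = \top -> x = y
}.

Record Lordered U (E P : Lrel U) : Prop := {
  Lordered_eq : Lequality E;
  Lordered_refl : Lreflexive P;
  Lordered_trans : Ltransitive P;
  Lordered_compat : forall u v u' v',
    P u v ⊗ E u u' ⊗ E v v' <= P u' v';
  Lordered_antisym : forall u v, P u v `&` P v u <= E u v
}.

Definition Ldown U (P : Lrel U) (V : Lset U) : Lset U :=
  fun u => ⋁ v, P u v ⊗ V v.
Definition Lup U (P : Lrel U) (V : Lset U) : Lset U :=
  fun u => ⋁ v, P v u ⊗ V v.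
Definition Lconvex U (P : Lrel U) (V : Lset U) : Prop :=
  V = Lsetcap (Ldown P V) (Lup P V).

Definition Lrel_Lset X (R : Lrel X) (B : Lset X) : Lset X :=
  fun x => ⋁ y, R x y ⊗ B y.
Definition Lset_Lrel X (A : Lset X) (R : Lrel X) : Lset X :=
  fun y => ⋁ x, A x ⊗ R x y.
Definition Lpower X (R : Lrel X) : Lrel (Lset X) :=
  fun A B => Lsubsethood A (Lrel_Lset R B) `&` Lsubsethood B (Lset_Lrel A R).

Definition Lrestrict X (M : set X) (R : Lrel X) : Lrel M :=
  fun x y => R (\val x) (\val y).

End LSets.

Arguments Lset {d} L X.
Arguments Lrel {d} L X.
Arguments Lrestrict {d L X} M R.

(* Main.v *)
Require Import Defs.
From mathcomp Require Import all_boot all_order.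
From mathcomp Require Import boolp classical_sets.

(** Power relations are monotone and [R1^+] composed with [R2^+] lies below
    [(R1 o R2)^+]; this gives reflexivity, symmetry and transitivity on the
    whole of [L^U], and also compatibility, because compatibility of the order
    forces [E <= P].  For a convex [B], the sets [P o B] and [B o P] are the
    down-closure and the up-closure of [B] and meet in [B], so that
    [P^+(A,B) /\ P^+(B,A) <= S(A,B)]. Since [S(A,B) <= S(A, E o B)], this yields
    antisymmetry; and [E^+(A,B) = 1] then gives [S(A,B) = S(B,A) = 1], that is
    [A = B]. *)

Section PowerRelations.
Set Implicit Arguments.
Unset Strict Implicit.
Unset Printing Implicit Defensive.
Import Order.TTheory.
Local Open Scope order_scope.

Section CompleteLattice.
Context {d : Order.disp_t} {L : completeLatticeType d}.

Lemma bigjoin_leP (I : Type) (F : I -> L) (c : L) :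
  (⋁ i, F i) <= c <-> forall i, F i <= c.
Proof.
rewrite /bigjoin /supremum; case: ifPn => [/eqP F0 | _].
  (* On an empty range [supremum] returns the default [\bot], which is below [c]; an index [i] would
     contradict emptiness. *)
  split=> [_ i | _]; last exact: le0x.
  have : range F (F i) by exists i.
  by rewrite F0.
(* Completeness makes [supremums] nonempty, so the point chosen by [xget] really is a least upper
   bound. *)
have /(xgetPex \bot)[ubF lubF] := has_supremum (range F).
split=> [le_c i | F_c].
  by apply: le_trans le_c; apply: ubF; exists i.
by apply: lubF => _ [i _ <-].
Qed.

Lemma bigjoin_sup (I : Type) (F : I -> L) (i : I) : F i <= ⋁ i, F i.
Proof. exact: (bigjoin_leP F _).1 (lexx _) i. Qed.

Lemma bigmeet_geP (I : Type) (F : I -> L) (c : L) :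
  c <= (⋀ i, F i) <-> forall i, c <= F i.
Proof.
rewrite /bigmeet /infimum; case: ifPn => [/eqP F0 | _].
  split=> [_ i | _]; last exact: lex1.
  have : range F (F i) by exists i.
  by rewrite F0.
have /(xgetPex \top)[lbF glbF] := has_infimum (range F).
split=> [c_le i | c_F].
  by apply: (le_trans c_le); apply: lbF; exists i.
by apply: glbF => _ [i _ <-].
Qed.

End CompleteLattice.

Context {d : Order.disp_t} {L : completeResiduatedLatticeType d}.

Lemma le_tensor2r (a b c : L) : a <= b -> a ⊗ c <= b ⊗ c.
Proof.
by move=> ab; rewrite adjointness; apply: (le_trans ab); rewrite -adjointness.
Qed.

Lemma le_tensor (a b a' b' : L) : a <= a' -> b <= b' -> a ⊗ b <= a' ⊗ b'.
Proof.
move=> aa' bb'; apply: (le_trans (le_tensor2r _ aa')).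
by rewrite ![a' ⊗ _]tensorC le_tensor2r.
Qed.

(** Tensoring with [a] is a left adjoint by [adjointness], so it preserves joins. *)
Lemma tensor_bigjoin_le (I : Type) (F : I -> L) (a c : L) :
  (forall i, a ⊗ F i <= c) -> a ⊗ (⋁ i, F i) <= c.
Proof.
move=> aF; rewrite tensorC adjointness; apply/bigjoin_leP => i.
by rewrite -adjointness tensorC.
Qed.

Section Sets.
Context {U : Type}.
Implicit Types (A B C : Lset L U) (R S T : Lrel L U).

Lemma Lsubsethood_geP A B (c : L) :
  c <= Lsubsethood A B <-> forall x, c ⊗ A x <= B x.
Proof.
split=> [/bigmeet_geP cS x | cAB]; first by rewrite adjointness.
by apply/bigmeet_geP => x; rewrite -adjointness.
Qed.

Lemma Lsubsethood_eval A B x : Lsubsethood A B ⊗ A x <= B x.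
Proof. exact: (Lsubsethood_geP A B _).1 (lexx _) x. Qed.

Lemma le_Lsubsethood A B C :
  (forall x, B x <= C x) -> Lsubsethood A B <= Lsubsethood A C.
Proof.
move=> BC; apply/Lsubsethood_geP => x.
exact: le_trans (Lsubsethood_eval A B x) (BC x).
Qed.

Lemma Lsubsethood_top A B :
  Lsubsethood A B = \top -> forall x, A x <= B x.
Proof.
by move=> AB x; have := Lsubsethood_eval A B x; rewrite AB tensor1l.
Qed.

(** With the converse, the second half of [Lpower] takes the same form as the first, and facts about
    [Lrel_Lset] serve both halves. *)
Definition Lconverse R : Lrel L U := fun x y => R y x.

Lemma Lset_Lrel_converse A R : Lset_Lrel A R = Lrel_Lset (Lconverse R) A.
Proof.
by apply: funext => y; congr bigjoin; apply: funext => x; rewrite tensorC.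
Qed.

Lemma LpowerE R A B :
  Lpower R A B =
  Lsubsethood A (Lrel_Lset R B) `&` Lsubsethood B (Lrel_Lset (Lconverse R) A).
Proof. by rewrite /Lpower Lset_Lrel_converse. Qed.

Lemma le_Lrel_Lset R S B x :
  (forall x y, R x y <= S x y) -> Lrel_Lset R B x <= Lrel_Lset S B x.
Proof.
move=> RS; apply/bigjoin_leP => y.
apply: le_trans (bigjoin_sup (fun y => S x y ⊗ B y) y).
exact: le_tensor2r.
Qed.

Lemma Lset_sub_Lrel_Lset R A x : Lreflexive R -> A x <= Lrel_Lset R A x.
Proof.
move=> Rxx; apply: le_trans (bigjoin_sup (fun y => R x y ⊗ A y) x).
by rewrite Rxx tensor1l.
Qed.

Lemma le_Lpower R S A B :
  (forall x y, R x y <= S x y) -> Lpower R A B <= Lpower S A B.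
Proof.
move=> RS; rewrite !LpowerE; apply: leI2; apply: le_Lsubsethood => x;
  by apply: le_Lrel_Lset => y z; apply: RS.
Qed.

Lemma Lpower_refl R : Lreflexive R -> Lreflexive (Lpower R).
Proof.
move=> Rxx A; apply/eqP; rewrite -le1x LpowerE lexI.
by apply/andP; split; apply/Lsubsethood_geP => x; rewrite tensor1l;
  apply: Lset_sub_Lrel_Lset => // y; apply: Rxx.
Qed.

Lemma Lpower_sym R : Lsymmetric R -> Lsymmetric (Lpower R).
Proof.
move=> Rsym A B; rewrite !LpowerE meetC.
by have -> : Lconverse R = R by do 2!apply: funext => ?; apply: Rsym.
Qed.

(** The degree [a] sends [A x] into the join of the [R x y ⊗ B y], and [b] then sends each [B y]
    into the join of the [S y z ⊗ C z]. Commutativity lets [b] wait until [B y] appears. *)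
Lemma Lsubsethood_comp R S T A B C :
  (forall x y z, R x y ⊗ S y z <= T x z) ->
  Lsubsethood A (Lrel_Lset R B) ⊗ Lsubsethood B (Lrel_Lset S C)
    <= Lsubsethood A (Lrel_Lset T C).
Proof.
move=> RST; set a := Lsubsethood A _; set b := Lsubsethood B _.
apply/Lsubsethood_geP => x; rewrite [a ⊗ b]tensorC -tensorA.
have Aa : b ⊗ (a ⊗ A x) <= b ⊗ Lrel_Lset R B x.
  by apply: le_tensor => //; apply: Lsubsethood_eval.
apply: (le_trans Aa); apply: tensor_bigjoin_le => y.
have -> : b ⊗ (R x y ⊗ B y) = R x y ⊗ (b ⊗ B y).
  by rewrite !tensorA [b ⊗ _]tensorC.
have Bb : R x y ⊗ (b ⊗ B y) <= R x y ⊗ Lrel_Lset S C y.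
  by apply: le_tensor => //; apply: Lsubsethood_eval.
apply: (le_trans Bb); apply: tensor_bigjoin_le => z.
apply: le_trans (bigjoin_sup (fun z => T x z ⊗ C z) z).
by rewrite tensorA le_tensor2r.
Qed.

Lemma Lpower_trans R : Ltransitive R -> Ltransitive (Lpower R).
Proof.
move=> Rtr A B C; rewrite !LpowerE lexI; apply/andP; split.
  apply: le_trans (Lsubsethood_comp A B C Rtr).
  by apply: le_tensor; apply: leIl.
(* The second halves compose backwards, from [C] through [B] to [A], so the two factors have to be
   swapped. *)
apply: (@le_trans _ _ (Lsubsethood C (Lrel_Lset (Lconverse R) B)
                       ⊗ Lsubsethood B (Lrel_Lset (Lconverse R) A))).
  by rewrite tensorC; apply: le_tensor; apply: leIr.
by apply: Lsubsethood_comp => x y z; rewrite tensorC; apply: Rtr.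
Qed.

Section Ordered.
Context {E P : Lrel L U} (HU : Lordered E P).

Lemma Lordered_eq_le x y : E x y <= P x y.
Proof.
(* Moving only the right end of [P x x = \top] along [E x y] yields [P x y]. *)
have := Lordered_compat HU x x x y.
by rewrite (Lordered_refl HU) (Lequality_refl (Lordered_eq HU)) !tensor1l.
Qed.

Lemma Lpower_meet_le_Lsubsethood A B :
  Lconvex P B -> Lpower P A B `&` Lpower P B A <= Lsubsethood A B.
Proof.
move=> cvxB; apply/Lsubsethood_geP => x.
have -> : B x = Lsetcap (Ldown P B) (Lup P B) x by rewrite {1}cvxB.
rewrite /Lsetcap lexI !LpowerE; apply/andP; split.
  (* [Ldown P B] is [Lrel_Lset P B] by conversion, and the first half of [Lpower P A B] bounds it.
     Likewise [Lup P B] is the image under [Lconverse P], handled by the second half of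
     [Lpower P B A]. *)
  apply: le_trans (Lsubsethood_eval A (Lrel_Lset P B) x).
  by apply: le_tensor2r; rewrite -meetA leIl.
apply: le_trans (Lsubsethood_eval A (Lrel_Lset (Lconverse P) B) x).
by apply: le_tensor2r; rewrite meetA leIr.
Qed.

Lemma Lpower_antisym A B : Lconvex P A -> Lconvex P B ->
  Lpower P A B `&` Lpower P B A <= Lpower E A B.
Proof.
move=> cvxA cvxB; have Exx := Lequality_refl (Lordered_eq HU).
rewrite [leRHS]LpowerE lexI; apply/andP; split.
  apply: le_trans (Lpower_meet_le_Lsubsethood A cvxB) _.
  by apply: le_Lsubsethood => x; apply: Lset_sub_Lrel_Lset.
rewrite meetC; apply: le_trans (Lpower_meet_le_Lsubsethood B cvxA) _.
by apply: le_Lsubsethood => x; apply: Lset_sub_Lrel_Lset => y; apply: Exx.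
Qed.

Lemma Lpower_eq_sub A B : Lconvex P B ->
  Lpower E A B = \top -> forall x, A x <= B x.
Proof.
move=> cvxB EAB; apply: Lsubsethood_top; apply/eqP; rewrite -le1x.
apply: le_trans (Lpower_meet_le_Lsubsethood A cvxB).
have EBA := Lpower_sym (Lequality_sym (Lordered_eq HU)) A B.
(* The two copies of [\top] become [Lpower E A B] and [Lpower E B A], so that [E <= P] bounds each
   by the matching value of [Lpower P]. *)
rewrite lexI -{1}EAB -EAB {2}EBA.
by apply/andP; split; apply: le_Lpower; apply: Lordered_eq_le.
Qed.

Lemma Lpower_sep A B : Lconvex P A -> Lconvex P B ->
  Lpower E A B = \top -> A = B.
Proof.
move=> cvxA cvxB EAB; have EBA := EAB.
rewrite (Lpower_sym (Lequality_sym (Lordered_eq HU))) in EBA.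
apply: funext => x; apply/le_anti/andP.
by split; apply: Lpower_eq_sub.
Qed.

(** Once [E] is replaced by the larger [P], this is transitivity along [A'], [A], [B], [B'];
    symmetry of [Lpower E] reverses the first link. *)
Lemma Lpower_compat A B A' B' :
  Lpower P A B ⊗ Lpower E A A' ⊗ Lpower E B B' <= Lpower P A' B'.
Proof.
have EP C D : Lpower E C D <= Lpower P C D.
  by apply: le_Lpower; apply: Lordered_eq_le.
have Ptr := Lpower_trans (Lordered_trans HU).
apply: le_trans (Ptr A' B B'); apply: le_tensor => //.
rewrite tensorC (Lpower_sym (Lequality_sym (Lordered_eq HU))).
by apply: le_trans (Ptr A' A B); apply: le_tensor.
Qed.

End Ordered.
End Sets.
End PowerRelations.

Theorem theorem7 (d : Order.disp_t) (L : completeResiduatedLatticeType d)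
    (U : Type) (E P : Lrel L U) (HU : Lordered E P)
    (M : set (Lset L U)) (HM : forall V : Lset L U, M V -> Lconvex P V) :
  Lordered (Lrestrict M (Lpower E)) (Lrestrict M (Lpower P)).
Proof.
have cvx (V : M) : Lconvex P (\val V) by apply: HM; apply: set_valP.
have [Exx Esym Etr _] := Lordered_eq HU.
split; first split.
- by move=> A; apply: Lpower_refl.
- by move=> A B; apply: Lpower_sym.
- by move=> A B C; apply: Lpower_trans.
- by move=> A B AB; apply: val_inj; apply: (Lpower_sep HU).
- by move=> A; apply: Lpower_refl; apply: Lordered_refl HU.
- by move=> A B C; apply: Lpower_trans; apply: Lordered_trans HU.
- by move=> A B A' B'; apply: (Lpower_compat HU).
- by move=> A B; apply: (Lpower_antisym HU).
Qed.
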